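(* Let $\delta\in\mathbb R^n$, let $L\in\mathbb R^{n\times n}$ be the Jacobian at $\delta$ of the flow function $P_e:\mathbb R^n\to\mathbb R^n$, $$P_{e_i}(\delta)=\sum_{j=1}^n V_iV_jY_{ij}\cos(\theta_{ij}-\delta_i+\delta_j),$$ let $M=\frac1{\omega_s}\mathbf{diag}(M_1,\dots,M_n)$ and $D=\frac1{\omega_s}\mathbf{diag}(D_1,\dots,D_n)$, and let $$J=\begin{bmatrix}0&I\\-M^{-1}L&-M^{-1}D\end{bmatrix}\in\mathbb R^{2n\times 2n}.$$ Then $\lambda\in\mathbb C$ is an eigenvalue of $J$ if and only if the matrix $P(\lambda):=\lambda^2M+\lambda D+L$ is singular.
   Context: Here $n\in\mathbb N$, and $V_i$, $Y_{ij}$, $\theta_{ij}$, $D_i$, $M_i\neq0$ and $\omega_s>0$ are real constants ($V_i$ terminal voltage magnitudes, $Y_{ij}e^{\sqrt{-1}\,\theta_{ij}}$ the entries of the reduced admittance matrix, $M_i$ inertia constants, $D_i$ damping coefficients, $\omega_s$ the synchronous angular velocity). $I$ is the $n\times n$ identity matrix. The entries of $L$ are $L_{ii}=\sum_{j\ne i}V_iV_jY_{ij}\sin(\theta_{ij}-\delta_i+\delta_j)$ and $L_{ij}=-V_iV_jY_{ij}\sin(\theta_{ij}-\delta_i+\delta_j)$ for $j\neq i$. The matrix $J$ is the Jacobian of the vector field of the swing equations $\dot\delta_i=\omega_i$, $\frac{M_i}{\omega_s}\dot\omega_i+\frac{D_i}{\omega_s}\omega_i=P_{m_i}-P_{e_i}(\delta)$,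 $i=1,\dots,n$, where the mechanical powers $P_{m_i}\in\mathbb R$ are constants. *)

(* Defs.v *)
From mathcomp Require Import all_boot all_order all_algebra.
From mathcomp Require Import all_classical all_reals all_analysis.
From mathcomp Require Import complex.

Set Implicit Arguments.
Unset Strict Implicit.
Unset Printing Implicit Defensive.

Import Order.TTheory GRing.Theory Num.Theory.
Import numFieldNormedType.Exports.
Local Open Scope ring_scope.

Definition flow (R : realType) (n : nat) (V : 'I_n -> R) (Y theta : 'M[R]_n)
    (delta : 'rV[R]_n) : 'rV[R]_n :=
  \row_i \sum_j V i * V j * Y i j
    * cos (theta i j - delta ord0 i + delta ord0 j).

(* ['J f p] acts on row vectors on the right (['d f p v = v *m 'J f p]), so the
   usual Jacobian matrix, with entry (i, j) equal to the partial derivative of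
   [f_i] with respect to the j-th variable, is its transpose. *)
Definition Jacobian (R : realType) (m n : nat) (f : 'rV[R]_m -> 'rV[R]_n)
    (p : 'rV[R]_m) : 'M[R]_(n, m) := ('J f p)^T.

Definition complex_mx (R : realType) (m n : nat) (A : 'M[R]_(m, n)) :
    'M[R[i]]_(m, n) := map_mx (real_complex R) A.

Definition swing_jacobian (R : realType) (n : nat) (M D L : 'M[R]_n) :
    'M[R]_(n + n) :=
  block_mx 0                  1%:M
           (- (invmx M *m L)) (- (invmx M *m D)).

Definition quadratic_pencil (R : realType) (n : nat) (M D L : 'M[R]_n)
    (lambda : R[i]) : 'M[R[i]]_n :=
  lambda ^+ 2 *: complex_mx M + lambda *: complex_mx D + complex_mx L.

(* Main.v *)
Require Import Defs.
From mathcomp Require Import all_boot all_order all_algebra.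
From mathcomp Require Import all_classical all_reals all_analysis.
From mathcomp Require Import complex.

Import Order.TTheory GRing.Theory Num.Theory.
Import numFieldNormedType.Exports.
Local Open Scope ring_scope.

(** The matrix [J] is the companion linearization of the quadratic pencil
    [P(lambda) = lambda^2 M + lambda D + L]: the equivalence is a fact of linear
    algebra over a field, resting on the invertibility of [M], a diagonal matrix
    with nonzero entries.  It is applied over the complex numbers, after the
    entrywise embedding of the real matrices, which commutes with products and
    inverses.

    Eigenvalues are witnessed here by row vectors, so the argument uses left
    eigenvectors.  Splitting such a vector as [(a, b)], the second block of
    [(a, b) J = lambda (a, b)] determines [a] from [c = b M^-1], namely
    [a = c (lambda M + D)]; the first block then becomes [c P(lambda) = 0]
    ([companion_eigenvectorP]).  Hence the left eigenvectors of [J] at [lambda]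
    correspond to the left null vectors of [P(lambda)], and neither side can
    vanish without the other.  A square matrix over a field is singular exactly
    when it has a nonzero left null vector, which gives the result. *)

Lemma singularP (F : fieldType) (n : nat) (A : 'M[F]_n) :
  reflect (exists2 v : 'rV_n, v *m A = 0 & v != 0) (A \notin unitmx).
Proof.
rewrite -row_free_unit -kermx_eq0.
by apply: (iffP rowV0Pn) => -[v /sub_kermxP ? ?]; exists v => //;
  apply/sub_kermxP.
Qed.

(** The second coordinate is written [c *m M] rather than [b], which is no loss
    of generality for invertible [M] and clears all inverses. *)
Lemma companion_eigenvectorP (F : fieldType) (n : nat) (M D L : 'M[F]_n)
    (lambda : F) (a c : 'rV[F]_n) :
  M \in unitmx ->
  row_mx a (c *m M) *m block_mx 0 1%:M (- (invmx M *m L)) (- (invmx M *m D))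
    = lambda *: row_mx a (c *m M) <->
  a = c *m (lambda *: M + D) /\
  c *m (lambda ^+ 2 *: M + lambda *: D + L) = 0.
Proof.
move=> M_unit.
rewrite mul_row_block scale_row_mx mulmx0 mulmx1 add0r !mulmxN !mulmxA.
rewrite !mulmxK //.
have pencilE : c *m (lambda ^+ 2 *: M + lambda *: D + L)
    = lambda *: (c *m (lambda *: M + D)) + c *m L.
  by rewrite !mulmxDr -!scalemxAr scalerDr scalerA -expr2.
have -> : (a = c *m (lambda *: M + D)) <-> (a - c *m D = lambda *: (c *m M)).
  rewrite mulmxDr -scalemxAr; split=> [->|<-]; first by rewrite addrK.
  by rewrite subrK.
rewrite pencilE; split.
- case/eq_row_mx=> eqL eqD; split=> //.
  by rewrite mulmxDr -scalemxAr -eqD subrK -eqL addNr.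
- case=> eqD /eqP; rewrite mulmxDr -scalemxAr -eqD subrK addrC addr_eq0.
  by move=> /eqP ->; rewrite opprK.
Qed.

Lemma companion_eigenvalueE (F : fieldType) (n : nat) (M D L : 'M[F]_n)
    (lambda : F) :
  M \in unitmx ->
  eigenvalue (block_mx 0 1%:M (- (invmx M *m L)) (- (invmx M *m D))) lambda
    = (lambda ^+ 2 *: M + lambda *: D + L \notin unitmx).
Proof.
move=> M_unit; apply/eigenvalueP/singularP => [[v vJ v_neq0] | [c cP c_neq0]].
- have vE : v = row_mx (lsubmx v) (rsubmx v *m invmx M *m M).
    by rewrite mulmxKV // hsubmxK.
  move: vJ; rewrite vE => /companion_eigenvectorP[//|a_eq cP].
  exists (rsubmx v *m invmx M) => //.
  (* If c = 0, then a = c (lambda M + D) vanishes too, hence so does v. *)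
  by apply: contra_neq v_neq0 => c0; rewrite vE a_eq c0 !mul0mx row_mx0.
- exists (row_mx (c *m (lambda *: M + D)) (c *m M)).
    exact/companion_eigenvectorP.
  apply: contra_neq c_neq0; rewrite -row_mx0 => /eq_row_mx[_ cM0].
  by rewrite -(mulmxK M_unit c) cM0 mul0mx.
Qed.

Lemma complex_swing_jacobian (R : realType) (n : nat) (M D L : 'M[R]_n) :
  complex_mx (swing_jacobian M D L) =
  block_mx 0 1%:M (- (invmx (complex_mx M) *m complex_mx L))
                  (- (invmx (complex_mx M) *m complex_mx D)).
Proof.
rewrite /complex_mx /swing_jacobian map_block_mx map_mx0 map_mx1 !map_mxN.
by rewrite !map_mxM map_invmx.
Qed.

Lemma scaled_diag_mx_unit (F : fieldType) (n : nat) (k : F) (d : 'rV[F]_n) :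
  k != 0 -> (forall i, d 0 i != 0) -> k *: diag_mx d \in unitmx.
Proof.
move=> k_neq0 d_neq0; rewrite unitmxE detZ det_diag unitfE mulf_neq0 //.
  exact: expf_neq0.
by apply/prodf_neq0 => i _; apply: d_neq0.
Qed.

Theorem lemma1 (R : realType) (n : nat)
    (V : 'I_n -> R) (Y theta : 'M[R]_n) (inertia damping : 'I_n -> R)
    (omega_s : R) (delta : 'rV[R]_n)
    (inertia_neq0 : forall i, inertia i != 0) (omega_s_gt0 : 0 < omega_s) :
  let L : 'M[R]_n := Jacobian (flow V Y theta) delta in
  let M : 'M[R]_n := omega_s^-1 *: diag_mx (\row_i inertia i) in
  let D : 'M[R]_n := omega_s^-1 *: diag_mx (\row_i damping i) in
  let J : 'M[R]_(n + n) := swing_jacobian M D L in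
  forall lambda : R[i],
    eigenvalue (complex_mx J) lambda <->
    quadratic_pencil M D L lambda \notin unitmx.
Proof.
move=> L M D J lambda.
have M_unit : M \in unitmx.
  apply: scaled_diag_mx_unit => [|i]; first by rewrite invr_eq0 gt_eqF.
  by rewrite mxE.
by rewrite complex_swing_jacobian companion_eigenvalueE // map_unitmx.
Qed.
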